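(* For every named $\mathrm{GS4}$ derivation $P$ with conclusion $\vdash\Gamma,A$, where $A$ is a non-atomic named formula, $\langle\!\langle\mathrm{isl}(P,A)\rangle\!\rangle=\langle\!\langle P\rangle\!\rangle$.
   Context: Named formulas and sequents. Fix a countably infinite set $\mathcal N$ of names and a set $\mathcal A$ of atoms with a fixpoint-free involution $\alpha\mapsto\bar\alpha$. Named formulas: $A,B::=\alpha^x\mid A\lor B\mid A\land B$ ($\alpha\in\mathcal A$, $x\in\mathcal N$); formulas $\alpha^x$ are atomic. Negation: $\overline{\alpha^x}=\bar\alpha^x$, $\overline{A\lor B}=\bar A\land\bar B$, $\overline{A\land B}=\bar A\lor\bar B$ (names preserved). $\mathrm{names}(A)$ is the set of names in $A$, $\mathrm{names}(\Gamma)=\bigcup_{A\in\Gamma}\mathrm{names}(A)$. $A\equiv B$ means $A,B$ coincide after erasing names. A formula is sharing-free if each name occurs in it at most once; a set is sharing-free if its members are sharing-free with pairwise disjoint name sets. A sequent $\vdash\Gamma$ is a finite sharing-free set $\Gamma$; in comma notation the components have pairwise disjoint name sets and $\Gamma,A=\Gamma\cup\{A\}$. Derivations. Named $\mathrm{GS4}$ derivations are finite trees of rule applications labelled with sharing-free sequents: axiom $\mathrm{ax}_{\{A,\bar B\}}$ (no premisses, conclusion $\vdash\Gamma,A,\bar B$, $A\equiv B$; principal formulas $A,\bar B$); cut (premisses $\vdash\Gamma,A$, $\vdash\Gamma,\bar A$, conclusion $\vdash\Gamma$); superposition $\sqcup$ (premisses $\vdash\Gamma$, $\vdash\Gamma$,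 conclusion $\vdash\Gamma$); $\lor$ (premiss $\vdash\Gamma,A,B$, conclusion $\vdash\Gamma,A\lor B$); $\land$ (premisses $\vdash\Gamma,A$, $\vdash\Gamma,B$, conclusion $\vdash\Gamma,A\land B$). Inversion and isolation. For $P$ with conclusion $\vdash\Gamma,A\lor B$, $\mathrm{inv}(P,A\lor B)$ (conclusion $\vdash\Gamma,A,B$) is defined by recursion on $P$: (1) if $P$ is an axiom with principal formulas $A\lor B$ and $\bar C\land\bar D$ ($A\equiv C$, $B\equiv D$, $\Gamma=\Delta,\bar C\land\bar D$), it is the $\land$ rule applied to $\mathrm{ax}_{\{\bar C,A\}}$ with conclusion $\vdash\Delta,\bar C,A,B$ and $\mathrm{ax}_{\{\bar D,B\}}$ with conclusion $\vdash\Delta,\bar D,A,B$; (2) if $P$ is $\mathrm{ax}_{\{C,\bar D\}}$ with conclusion $\vdash\Delta,C,\bar D,A\lor B$, it is $\mathrm{ax}_{\{C,\bar D\}}$ with conclusion $\vdash\Delta,C,\bar D,A,B$; (3) if $P$ ends with a $\lor$ rule introducing $A\lor B$ with premiss derivation $Q$, it is $Q$; (4) otherwise apply the same last rule to the recursively inverted premiss derivations. For $P$ with conclusion $\vdash\Gamma,A\land B$, $\mathrm{inv}_l(P,A\land B)$ (conclusion $\vdash\Gamma,A$): (1) if $P$ is an axiom with principal formulas $A\land B$ and $\bar C\lor\bar D$ ($A\equiv C$, $B\equiv D$, $\Gamma=\Delta,\bar C\lor\bar D$), it is the $\lor$ rule applied to $\mathrm{ax}_{\{\bar C,A\}}$ with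 conclusion $\vdash\Delta,\bar C,\bar D,A$; (2) if $P$ is $\mathrm{ax}_{\{C,\bar D\}}$ with conclusion $\vdash\Delta,C,\bar D,A\land B$, it is $\mathrm{ax}_{\{C,\bar D\}}$ with conclusion $\vdash\Delta,C,\bar D,A$; (3) if $P$ ends with a $\land$ rule introducing $A\land B$ with premiss derivations $Q$ (of $\vdash\Gamma,A$) and $R$ (of $\vdash\Gamma,B$), it is $Q$; (4) otherwise recurse into all premisses and reapply the last rule. $\mathrm{inv}_r(P,A\land B)$ (conclusion $\vdash\Gamma,B$) is symmetric: in (1) the $\lor$ rule applied to $\mathrm{ax}_{\{\bar D,B\}}$ with conclusion $\vdash\Delta,\bar C,\bar D,B$; in (2) $A\land B$ replaced by $B$; in (3) it is $R$. $\mathrm{isl}(P,A\lor B)$ is the $\lor$ rule applied to $\mathrm{inv}(P,A\lor B)$; $\mathrm{isl}(P,A\land B)$ is the $\land$ rule applied to $\mathrm{inv}_l(P,A\land B)$ and $\mathrm{inv}_r(P,A\land B)$. Branches. $\mathrm{Br}(\alpha^x)=\{\{x\}\}$, $\mathrm{Br}(B\lor C)=\{X\cup Y\mid X\in\mathrm{Br}(B),Y\in\mathrm{Br}(C)\}$, $\mathrm{Br}(B\land C)=\mathrm{Br}(B)\cup\mathrm{Br}(C)$; for sharing-free $\Gamma$, $\mathrm{Br}(\Gamma)=\{X\subseteq\mathrm{names}(\Gamma)\mid\forall A\in\Gamma,\ X\cap\mathrm{names}(A)\in\mathrm{Br}(A)\}$. Branch-labeled graphs. A bl-graph is $G=\langle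 V_G,\triangleleft_G\rangle$ with $V_G\subseteq\mathcal N$ and $\triangleleft_G$ a relation between 2-element subsets $e$ of $V_G$ and subsets $X\subseteq V_G$ such that $e\triangleleft_G X$ implies $e\subseteq X$. Union $\sqcup$ is componentwise union; equality is equality of both components. For $I\subseteq\mathcal N$: $e\triangleleft^I_G X$ iff $e\triangleleft_G Y$ for some $Y$ with $X=Y\setminus I$. An alternating $X$-labeled path between bl-graphs $G,H$ through $I$ is a sequence $x_1,\dots,x_n$ ($n>1$) of pairwise distinct vertices of $G$ or $H$ with $x_i\in I$ for $1<i<n$ such that either $x_ix_{i+1}\triangleleft^I_G X$ for all odd $i$ and $x_ix_{i+1}\triangleleft^I_H X$ for all even $i$, or the same with $G,H$ swapped; it is complete if $x_1,x_n\notin I$. $G\odot_I H$ has vertex set $V=(V_G\cup V_H)\setminus I$ and, for $x\ne y\in V$, $X\subseteq V$, $xy\triangleleft X$ iff there is a complete alternating $X$-labeled path from $x$ to $y$ between $G$ and $H$ through $I$; $\odot_A=\odot_{\mathrm{names}(A)}$. $\mathrm{wk}_\Gamma(G)=\langle V_G\cup\mathrm{names}(\Gamma),\{(e,X\cup Y)\mid e\triangleleft_G X,\,Y\in\mathrm{Br}(\Gamma)\}\rangle$. $\mathrm{id}_{\{\alpha^x,\bar\alpha^y\}}=\langle\{x,y\},\{(xy,\{x,y\})\}\rangle$, and for disjoint sharing-free $A_1\lor A_2$, $\bar B_1\land\bar B_2$ with $A_i\equiv B_i$, $\mathrm{id}_{\{A_1\lor A_2,\bar B_1\land\bar B_2\}}=\mathrm{wk}_{\{A_2\}}(\mathrm{id}_{\{A_1,\bar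 B_1\}})\sqcup\mathrm{wk}_{\{A_1\}}(\mathrm{id}_{\{A_2,\bar B_2\}})$ (every axiom pair of non-atomic formulas is an unordered pair of this shape). $\langle\!\langle P\rangle\!\rangle$ is $\mathrm{wk}_\Gamma(\mathrm{id}_{\{A,\bar B\}})$ for an axiom $\mathrm{ax}_{\{A,\bar B\}}$ with conclusion $\vdash\Gamma,A,\bar B$; $\langle\!\langle Q\rangle\!\rangle\odot_A\langle\!\langle R\rangle\!\rangle$ for a cut with premiss derivations $Q$ of $\vdash\Gamma,A$, $R$ of $\vdash\Gamma,\bar A$; the union of the premisses' bl-graphs for $\sqcup,\lor,\land$. *)

(* Defs.v *)
From HB Require Import structures.
From mathcomp Require Import all_boot finmap.
From mathcomp Require Import boolp classical_sets.

Set Implicit Arguments.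
Unset Strict Implicit.
Unset Printing Implicit Defensive.

Local Open Scope fset_scope.
Local Open Scope classical_set_scope.

(* Throughout, [At] is the set of atoms, [bar] its fixpoint-free
   involution and [N] the set of names. *)

Inductive formula (At N : Type) : Type :=
| Atom of At & N
| Disj of formula At N & formula At N
| Conj of formula At N & formula At N.

Section FormulaChoice.
Variables At N : Type.

Fixpoint formula_encode (A : formula At N) : GenTree.tree (At * N) :=
  match A with
  | Atom a x => GenTree.Leaf (a, x)
  | Disj B C => GenTree.Node 0 [:: formula_encode B; formula_encode C]
  | Conj B C => GenTree.Node 1 [:: formula_encode B; formula_encode C]
  end.

Fixpoint formula_decode (t : GenTree.tree (At * N)) : option (formula At N) :=
  match t with
  | GenTree.Leaf u => Some (Atom u.1 u.2)
  | GenTree.Node 0 [:: t1; t2] =>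
      if formula_decode t1 is Some B then
        if formula_decode t2 is Some C then Some (Disj B C) else None
      else None
  | GenTree.Node 1 [:: t1; t2] =>
      if formula_decode t1 is Some B then
        if formula_decode t2 is Some C then Some (Conj B C) else None
      else None
  | _ => None
  end.

Lemma formula_encodeK : pcancel formula_encode formula_decode.
Proof. by elim=> //= B -> C ->. Qed.

End FormulaChoice.

HB.instance Definition _ (At N : choiceType) :=
  Choice.copy (formula At N) (pcan_type (@formula_encodeK At N)).

Section Formulas.
Variables At N : choiceType.
Notation form := (formula At N).

Fixpoint neg (bar : At -> At) (A : form) : form :=
  match A with
  | Atom a x => Atom (bar a) x
  | Disj B C => Conj (neg bar B) (neg bar C)
  | Conj B C => Disj (neg bar B) (neg bar C)
  end.

Definition atomic (A : form) : bool := if A is Atom _ _ then true else false.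

(* The occurrences of names in A, with multiplicity. *)
Fixpoint occ (A : form) : seq N :=
  match A with
  | Atom _ x => [:: x]
  | Disj B C | Conj B C => occ B ++ occ C
  end.

Definition names (A : form) : set N := [set` occ A].

Definition names_set (G : {fset form}) : set N :=
  \bigcup_(A in [set` G]) names A.

Fixpoint erase (A : form) : formula At unit :=
  match A with
  | Atom a _ => Atom a tt
  | Disj B C => Disj (erase B) (erase C)
  | Conj B C => Conj (erase B) (erase C)
  end.

Definition same_shape (A B : form) : Prop := erase A = erase B.

Definition sharing_free (A : form) : Prop := uniq (occ A).

Definition sharing_free_set (G : {fset form}) : Prop :=
  (forall A, A \in G -> sharing_free A) /\
  (forall A B, A \in G -> B \in G -> A <> B -> names A `&` names B = set0).

(* Side condition of the comma: in "G, A" the names of A do not occur in G.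
   Formulas have at least one name, so this entails A \notin G. *)
Definition apart (A : form) (G : {fset form}) : Prop :=
  forall B, B \in G -> names A `&` names B = set0.

Fixpoint Br (A : form) : set (set N) :=
  match A with
  | Atom _ x => [set [set x]]
  | Disj B C => [set X `|` Y | X in Br B & Y in Br C]
  | Conj B C => Br B `|` Br C
  end.

Definition Br_set (G : {fset form}) : set (set N) :=
  [set X | X `<=` names_set G /\ forall A, A \in G -> Br A (X `&` names A)].

End Formulas.

Section Derivations.
Variables At N : choiceType.
Notation form := (formula At N).

(* Raw trees of rule instances. The argument [G] is the context and the
   formulas are the principal ones, or the cut formula; see [concl] for the
   conclusions. The premisses of a [Cut] on A derive A and its negation,
   in this order. *)
Inductive tree : Type :=
| Ax (G : {fset form}) (A B : form)
| Cut (G : {fset form}) (A : form) (Q R : tree)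
| Sup (G : {fset form}) (Q R : tree)
| DisjR (G : {fset form}) (A B : form) (Q : tree)
| ConjR (G : {fset form}) (A B : form) (Q R : tree).

Definition concl (P : tree) : {fset form} :=
  match P with
  | Ax G A B => (A |` (B |` G))%fset
  | Cut G _ _ _ => G
  | Sup G _ _ => G
  | DisjR G A B _ => (Disj A B |` G)%fset
  | ConjR G A B _ _ => (Conj A B |` G)%fset
  end.

(* The pair {A, B} of principal formulas of an axiom is unordered: both
   [Ax G A B] and [Ax G B A] represent it, and the condition is symmetric. *)
Fixpoint derivation (bar : At -> At) (P : tree) : Prop :=
  sharing_free_set (concl P) /\
  match P with
  | Ax G A B =>
      [/\ apart A (B |` G)%fset, apart B G & same_shape A (neg bar B)]
  | Cut G A Q R =>
      [/\ apart A G, concl Q = (A |` G)%fset, concl R = (neg bar A |` G)%fset,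
          derivation bar Q & derivation bar R]
  | Sup G Q R =>
      [/\ concl Q = G, concl R = G, derivation bar Q & derivation bar R]
  | DisjR G A B Q =>
      [/\ apart A (B |` G)%fset, apart B G, concl Q = (A |` (B |` G))%fset
        & derivation bar Q]
  | ConjR G A B Q R =>
      [/\ apart A (B |` G)%fset, apart B G, concl Q = (A |` G)%fset,
          concl R = (B |` G)%fset & derivation bar Q /\ derivation bar R]
  end.

(* The inversions are total on trees; the fall-through case of an axiom on F
   whose other principal formula is not of the dual form does not occur in
   derivations. *)
Section Inversion.
Variables A B : form.

Section Disjunction.
Let F := Disj A B.
Let repl (G : {fset form}) : {fset form} := (A |` (B |` (G `\ F)))%fset.

(* An axiom on F and Conj C D, with remaining context G. *)
Let invd_ax G C D :=
  ConjR (A |` (B |` G))%fset C D (Ax (B |` G)%fset C A) (Ax (A |` G)%fset D B).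

Fixpoint invd (P : tree) : tree :=
  match P with
  | Ax G C D =>
      if C == F then (if D is Conj D1 D2 then invd_ax G D1 D2 else P)
      else if D == F then (if C is Conj C1 C2 then invd_ax G C1 C2 else P)
      else Ax (repl G) C D
  | Cut G C Q R => Cut (repl G) C (invd Q) (invd R)
  | Sup G Q R => Sup (repl G) (invd Q) (invd R)
  | DisjR G C D Q =>
      if Disj C D == F then Q else DisjR (repl G) C D (invd Q)
  | ConjR G C D Q R => ConjR (repl G) C D (invd Q) (invd R)
  end.
End Disjunction.

Section Conjunction.
Let F := Conj A B.

Section Left.
Let repl (G : {fset form}) : {fset form} := (A |` (G `\ F))%fset.
Let invl_ax G C D := DisjR (A |` G)%fset C D (Ax (D |` G)%fset C A).

Fixpoint invl (P : tree) : tree :=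
  match P with
  | Ax G C D =>
      if C == F then (if D is Disj D1 D2 then invl_ax G D1 D2 else P)
      else if D == F then (if C is Disj C1 C2 then invl_ax G C1 C2 else P)
      else Ax (repl G) C D
  | Cut G C Q R => Cut (repl G) C (invl Q) (invl R)
  | Sup G Q R => Sup (repl G) (invl Q) (invl R)
  | DisjR G C D Q => DisjR (repl G) C D (invl Q)
  | ConjR G C D Q R =>
      if Conj C D == F then Q else ConjR (repl G) C D (invl Q) (invl R)
  end.
End Left.

Section Right.
Let repl (G : {fset form}) : {fset form} := (B |` (G `\ F))%fset.
Let invr_ax G C D := DisjR (B |` G)%fset C D (Ax (C |` G)%fset D B).

Fixpoint invr (P : tree) : tree :=
  match P with
  | Ax G C D =>
      if C == F then (if D is Disj D1 D2 then invr_ax G D1 D2 else P)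
      else if D == F then (if C is Disj C1 C2 then invr_ax G C1 C2 else P)
      else Ax (repl G) C D
  | Cut G C Q R => Cut (repl G) C (invr Q) (invr R)
  | Sup G Q R => Sup (repl G) (invr Q) (invr R)
  | DisjR G C D Q => DisjR (repl G) C D (invr Q)
  | ConjR G C D Q R =>
      if Conj C D == F then R else ConjR (repl G) C D (invr Q) (invr R)
  end.
End Right.
End Conjunction.
End Inversion.

(* Isolation is only meaningful for non-atomic A; the value on atoms is junk. *)
Definition isl (P : tree) (A : form) : tree :=
  let G := (concl P `\ A)%fset in
  match A with
  | Atom _ _ => P
  | Disj B C => DisjR G B C (invd B C P)
  | Conj B C => ConjR G B C (invl B C P) (invr B C P)
  end.

End Derivations.

#[local] Obligation Tactic := idtac.

Section Graphs.
Variables At N : choiceType.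
Notation form := (formula At N).

Record blgraph : Type := BLGraph {
  vert : set N;
  tri : set N -> set N -> Prop;
  tri_edge : forall e X, tri e X -> exists x y, x <> y /\ e = [set x; y];
  tri_sub : forall e X, tri e X -> e `<=` X;
  tri_vert : forall e X, tri e X -> X `<=` vert }.

Lemma blgraphP (G H : blgraph) :
  G = H <-> vert G = vert H /\ (forall e X, tri G e X <-> tri H e X).
Proof.
split=> [-> //|]; case: G => V t p q r; case: H => V' t' p' q' r' /= [eV et].
have {}et : t = t' by apply/funext => e; apply/funext => X; apply/propext.
by subst V' t'; congr BLGraph; apply: Prop_irrelevance.
Qed.

Program Definition bl_empty : blgraph :=
  @BLGraph set0 (fun _ _ => False) _ _ _.
Solve Obligations with by [].

Program Definition bl_edge (x y : N) : blgraph :=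
  @BLGraph [set x; y]
    (fun e X => [/\ x <> y, e = [set x; y] & X = [set x; y]]) _ _ _.
Next Obligation. by move=> x y e X [? -> _]; exists x, y. Qed.
Next Obligation. by move=> x y e X [_ -> ->]. Qed.
Next Obligation. by move=> x y e X [_ _ ->]. Qed.

Program Definition bl_union (G H : blgraph) : blgraph :=
  @BLGraph (vert G `|` vert H) (fun e X => tri G e X \/ tri H e X) _ _ _.
Next Obligation. by move=> G H e X [] /tri_edge. Qed.
Next Obligation. by move=> G H e X [] /tri_sub. Qed.
Next Obligation.
move=> G H e X [] /tri_vert XV x Xx; [left|right]; exact: XV.
Qed.

Program Definition wk (D : {fset form}) (G : blgraph) : blgraph :=
  @BLGraph (vert G `|` names_set D)
    (fun e Z => exists X Y, [/\ tri G e X, Br_set D Y & Z = X `|` Y]) _ _ _.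
Next Obligation. by move=> D G e Z [X [Y [/tri_edge]]]. Qed.
Next Obligation.
by move=> D G e Z [X [Y [/tri_sub eX _ ->]]] x ex; left; apply: eX.
Qed.
Next Obligation.
by move=> D G e Z [X [Y [/tri_vert XV [YD _] ->]]]; apply: setUSS.
Qed.

Definition tri_mod (I : set N) (G : blgraph) (e X : set N) : Prop :=
  exists Y, tri G e Y /\ X = Y `\` I.

(* [x :: s] is x_1, ..., x_n with indices shifted by one, hence the exchange of
   parities. *)
Definition alternates (I X : set N) (G H : blgraph) (x : N) (s : seq N) : Prop :=
  forall i, i < size s ->
    tri_mod I (if odd i then H else G)
      [set nth x (x :: s) i; nth x (x :: s) i.+1] X.

Definition alt_path (I X : set N) (G H : blgraph) (x : N) (s : seq N) : Prop :=
  [/\ s != [::],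
      uniq (x :: s),
      forall z, z \in x :: s -> (vert G `|` vert H) z,
      forall i, 0 < i < size s -> I (nth x (x :: s) i)
    & alternates I X G H x s \/ alternates I X H G x s].

Definition complete (I : set N) (x : N) (s : seq N) : Prop :=
  ~ I x /\ ~ I (last x s).

Lemma alt_path_head I X G H x s :
  alt_path I X G H x s -> ~ I x -> X x.
Proof.
case; case: s => // y s _ _ _ _ alt nIx.
have mem K : tri_mod I K [set x; y] X -> X x.
  by move=> [Y [/tri_sub eY ->]]; split=> //; apply: eY; left.
by case: alt => /(_ 0 isT) /mem.
Qed.

Lemma alt_path_last I X G H x s :
  alt_path I X G H x s -> ~ I (last x s) -> X (last x s).
Proof.
case; case: s => // y s _ _ _ _ alt nIl.
have mem K z : tri_mod I K [set z; last x (y :: s)] X -> X (last x (y :: s)).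
  by move=> [Y [/tri_sub eY ->]]; split=> //; apply: eY; right.
have lastE : last x (y :: s) = nth x [:: x, y & s] (size s).+1.
  by rewrite (last_nth x).
by case: alt => /(_ (size s) (leqnn _)); rewrite -lastE => /mem.
Qed.

Program Definition odot (I : set N) (G H : blgraph) : blgraph :=
  let V := (vert G `|` vert H) `\` I in
  @BLGraph V
    (fun e X => exists x y,
       [/\ e = [set x; y], x <> y, V x, V y & X `<=` V /\
         exists s, [/\ alt_path I X G H x s, complete I x s & last x s = y]])
    _ _ _.
Next Obligation. by move=> I G H V e X [x [y [-> xy _ _ _]]]; exists x, y. Qed.
Next Obligation.
move=> I G H V e X [x [y [-> _ _ _ [_ [s [p [nIx nIl] <-]]]]]] z [->|->].
  exact: alt_path_head p nIx.
exact: alt_path_last p nIl.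
Qed.
Next Obligation. by move=> I G H V e X [x [y [_ _ _ _ [XV _]]]]. Qed.

(* Symmetric in its arguments; junk on pairs that are not axiom pairs. *)
Fixpoint bl_id (A B : form) : blgraph :=
  match A, B with
  | Atom _ x, Atom _ y => bl_edge x y
  | Disj A1 A2, Conj B1 B2 =>
      bl_union (wk [fset A2]%fset (bl_id A1 B1)) (wk [fset A1]%fset (bl_id A2 B2))
  | Conj A1 A2, Disj B1 B2 =>
      bl_union (wk [fset B2]%fset (bl_id A1 B1)) (wk [fset B1]%fset (bl_id A2 B2))
  | _, _ => bl_empty
  end.

Fixpoint sem (P : tree At N) : blgraph :=
  match P with
  | Ax G A B => wk G (bl_id A B)
  | Cut _ A Q R => odot (names A) (sem Q) (sem R)
  | Sup _ Q R => bl_union (sem Q) (sem R)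
  | DisjR _ _ _ Q => sem Q
  | ConjR _ _ _ Q R => bl_union (sem Q) (sem R)
  end.

End Graphs.

(* Main.v *)
(* Inverting a disjunction leaves the bl-graph unchanged rule by rule, and
   inverting a conjunction A /\ B splits it into a left and a right half. The
   delicate case is a cut, where an alternating path might jump between the two
   halves: labels of the left half meet names(A), labels of the right half avoid
   names(A), and names(A) is disjoint from the names cut out, so the label
   common to all edges of the path determines its half. *)
Require Import Defs.
From mathcomp Require Import all_boot finmap.
From mathcomp Require Import boolp classical_sets cardinality.

Set Implicit Arguments.
Unset Strict Implicit.
Unset Printing Implicit Defensive.

Local Open Scope fset_scope.
Local Open Scope classical_set_scope.

(** * Names, apartness and branches of named formulas *)

Section Names.
Variables At N : choiceType.
Notation form := (formula At N).
Implicit Types (A B C D : form) (G : {fset form}) (X Y : set N).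

Lemma names_Disj A B : names (Disj A B) = names A `|` names B.
Proof. by apply/seteqP; split=> x; rewrite /names /= mem_cat => /orP. Qed.

Lemma names_Conj A B : names (Conj A B) = names A `|` names B.
Proof. by apply/seteqP; split=> x; rewrite /names /= mem_cat => /orP. Qed.

Lemma names_neg bar A : names (neg bar A) = names A.
Proof.
by elim: A => [//|A IA B IB|A IA B IB] /=; rewrite names_Conj names_Disj IA IB.
Qed.

Lemma sharing_free_Disj A B :
  sharing_free (Disj A B) -> names A `&` names B = set0.
Proof.
rewrite /sharing_free /= cat_uniq => /and3P[_ /hasPn st _].
by apply/seteqP; split=> // x [/= xs /st /negP].
Qed.

Lemma sharing_free_Conj A B :
  sharing_free (Conj A B) -> names A `&` names B = set0.
Proof. exact: sharing_free_Disj. Qed.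

Lemma names_setU1 A G : names_set (A |` G)%fset = names A `|` names_set G.
Proof.
apply/seteqP; split=> [x [B /= /fset1UP[->|BG] Bx]|x [Ax|[B BG Bx]]].
- by left.
- by right; exists B.
- by exists A => //=; rewrite fset1U1.
- by exists B => //=; rewrite fset1Ur.
Qed.

Lemma names_set_sub A G : A \in G -> names A `<=` names_set G.
Proof. by move=> AG x Ax; exists A. Qed.

Lemma names_set1 A : names_set [fset A]%fset = names A.
Proof.
apply/seteqP; split=> [x [B /= /fset1P -> //]|x Ax].
by exists A => //=; rewrite fset11.
Qed.

Lemma apart_names_set A G : apart A G -> names A `&` names_set G = set0.
Proof.
move=> AG; apply/seteqP; split=> // x [Ax [B BG Bx]].
by rewrite -(AG _ BG).
Qed.

Lemma apartU1 A B G :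
  apart A (B |` G)%fset <-> names A `&` names B = set0 /\ apart A G.
Proof.
split=> [AG|[AB AG] C /fset1UP[->//|/AG//]].
by split=> [|C CG]; apply: AG; rewrite ?fset1U1 ?fset1Ur.
Qed.

Lemma apart_Disj A B G : apart (Disj A B) G <-> apart A G /\ apart B G.
Proof.
rewrite /apart names_Disj; split=> [FG|[AG BG] C CG].
  by split=> C /FG; rewrite setIUl setU_eq0 => -[].
by rewrite setIUl AG // BG // setU0.
Qed.

Lemma apart_Conj A B G : apart (Conj A B) G <-> apart A G /\ apart B G.
Proof. by rewrite -apart_Disj /apart names_Conj names_Disj. Qed.

Lemma disjointP (T : Type) (X Y : set T) :
  X `&` Y = set0 <-> forall x, X x -> Y x -> False.
Proof.
split=> [XY x Xx Yx|XY]; first by rewrite -[False]/(set0 x) -XY.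
by apply/seteqP; split=> // x [Xx /(XY _ Xx)].
Qed.

(** At an axiom whose principal formulas differ from the inverted one, that formula lies in the
    context [G], while sharing-freeness is known for the whole conclusion [H]. *)
Lemma sharing_free_setD1 A G H :
  sharing_free_set H -> A \in H -> {subset G <= H} -> apart A (G `\ A)%fset.
Proof.
move=> [_ sh] AH GH B; rewrite in_fsetD1 => /andP[/eqP BA BG].
by apply: sh => //; [exact: GH|move=> AB; apply: BA].
Qed.

Lemma Br_sub A X : Br A X -> X `<=` names A.
Proof.
elim: A X => [a x|A IA B IB|A IA B IB] X.
- by move=> /= -> y ->; rewrite /names /= inE.
- by rewrite names_Disj => -[Y /IA YA [Z /IB ZB <-]]; apply: setUSS.
- by rewrite names_Conj => -[/IA|/IB] XA; apply: subset_trans XA _ => x; [left|right].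
Qed.

Lemma Br_neq0 A X : Br A X -> X !=set0.
Proof.
elim: A X => [a x|A IA B IB|A IA B IB] X /=.
- by move=> ->; exists x.
- by move=> [Y /IA[x Yx] [Z _ <-]]; exists x; left.
- by case=> [/IA|/IB].
Qed.

(** The trace of [X] on [A] is itself a branch of [A], and no branch is empty. *)
Lemma Br_set_hits G X A : Br_set G X -> A \in G -> X `&` names A !=set0.
Proof. by move=> [_ GX] /GX /Br_neq0. Qed.

(** The two pieces are the traces of [X] on the names of [A] and on those of [G]. When pieces are
    glued back, apartness makes the cross intersections empty. *)
Lemma Br_setU1 A G X : apart A G ->
  Br_set (A |` G)%fset X <->
  exists Y Z, [/\ Br A Y, Br_set G Z & X = Y `|` Z].
Proof.
move=> AG; split=> [[XG brX]|[Y [Z [AY [ZG brZ] ->]]]].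
  exists (X `&` names A), (X `&` names_set G); split.
  - by apply: brX; rewrite fset1U1.
  - split=> [|B BG]; first exact: subIsetr.
    rewrite -setIA [names_set G `&` _]setIC (setIidl (names_set_sub BG)).
    by apply: brX; rewrite fset1Ur.
  - by rewrite -setIUr -names_setU1 (setIidl XG).
split=> [|B /fset1UP[->|BG]].
- rewrite names_setU1; apply: setUSS ZG; exact: Br_sub.
- have ZA : Z `&` names A = set0.
    apply/disjointP => x /ZG Gx Ax; move: (apart_names_set AG) => /disjointP.
    by apply; eauto.
  by rewrite setIUl ZA setU0 (setIidl (Br_sub AY)).
- have YB : Y `&` names B = set0.
    apply/disjointP => x /(Br_sub AY) Ax Bx; move: (AG _ BG) => /disjointP.
    by apply; eauto.
  by rewrite setIUl YB set0U; apply: brZ.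
Qed.

Lemma Br_set1 A X : Br_set [fset A]%fset X <-> Br A X.
Proof.
split=> [[XA /(_ A (fset11 A))]|AX].
  by rewrite names_set1 in XA; rewrite (setIidl XA).
split=> [|B /fset1P ->]; first by rewrite names_set1; apply: Br_sub.
by rewrite (setIidl (Br_sub AX)).
Qed.

End Names.

(** * Weakening and identity bl-graphs *)

Section Graphs.
Variables At N : choiceType.
Notation form := (formula At N).
Implicit Types (A B C D : form) (G : {fset form}) (K L : blgraph N).

Lemma bl_unionACA K1 K2 L1 L2 :
  bl_union (bl_union K1 K2) (bl_union L1 L2) =
  bl_union (bl_union K1 L1) (bl_union K2 L2).
Proof.
by apply/blgraphP; split=> [|e X] /=; [rewrite setUACA|tauto].
Qed.

Lemma wk_union G K L : wk G (bl_union K L) = bl_union (wk G K) (wk G L).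
Proof.
apply/blgraphP; split=> [|e X] /=; first by rewrite setUACA setUid.
split=> [[Y [Z [[t|t] GZ ->]]]|[[Y [Z [t GZ ->]]]|[Y [Z [t GZ ->]]]]].
- by left; exists Y, Z.
- by right; exists Y, Z.
- by exists Y, Z; split=> //; left.
- by exists Y, Z; split=> //; right.
Qed.

(** Absorbs the one-formula weakenings in [bl_id] into the context of an axiom. *)
Lemma wkU1 A G K : apart A G ->
  wk (A |` G)%fset K = wk G (wk [fset A]%fset K).
Proof.
move=> AG; apply/blgraphP; split=> [|e X] /=.
  by rewrite names_setU1 names_set1 setUA.
split=> [[Y [Z [t /(Br_setU1 _ AG)[U [V [AU GV ->]]] ->]]]|].
  exists (Y `|` U), V; rewrite setUA; split=> //.
  by exists Y, U; split=> //; apply/Br_set1.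
move=> [_ [V [[Y [U [t /Br_set1 AU ->]]] GV ->]]].
exists Y, (U `|` V); rewrite setUA; split=> //.
by apply/Br_setU1 => //; exists U, V.
Qed.

(** A branch of a disjunction joins one branch of each disjunct, exactly as a set containing both
    disjuncts requires. *)
Lemma wk_Disj A B G K :
  apart A (B |` G)%fset -> apart B G ->
  wk (Disj A B |` G)%fset K = wk (A |` (B |` G))%fset K.
Proof.
move=> AG BG; have FG : apart (Disj A B) G.
  by apply/apart_Disj; move: AG => /apartU1[].
apply/blgraphP; split=> [|e X] /=; first by rewrite !names_setU1 names_Disj !setUA.
split=> [[Y [Z [t /(Br_setU1 _ FG)[_ [W [[U AU [V BV <-]] GW ->]]] ->]]]|].
  exists Y, (U `|` V `|` W); split=> //; rewrite -setUA.
  apply/(Br_setU1 _ AG); exists U, (V `|` W); split=> //.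
  by apply/(Br_setU1 _ BG); exists V, W.
move=> [Y [_ [t /(Br_setU1 _ AG)[U [_ [AU /(Br_setU1 _ BG)[V [W [BV GW ->]]] ->]]] ->]]].
exists Y, (U `|` V `|` W); rewrite !setUA; split=> //.
by apply/(Br_setU1 _ FG); exists (U `|` V), W; split=> //; exists U => //; exists V.
Qed.

(** A branch of a conjunction is a branch of one conjunct, so a conjunction in the context of an
    axiom already separates the left half from the right half. *)
Lemma wk_Conj A B G K : apart A G -> apart B G ->
  wk (Conj A B |` G)%fset K = bl_union (wk (A |` G)%fset K) (wk (B |` G)%fset K).
Proof.
move=> AG BG; have FG : apart (Conj A B) G by apply/apart_Conj.
apply/blgraphP; split=> [|e X] /=.
  by rewrite !names_setU1 names_Conj setUACA setUid setUACA setUid.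
split=> [[Y [Z [t /(Br_setU1 _ FG)[U [V [[AU|BU] GV ->]]] ->]]]|].
- by left; exists Y, (U `|` V); split=> //; apply/(Br_setU1 _ AG); exists U, V.
- by right; exists Y, (U `|` V); split=> //; apply/(Br_setU1 _ BG); exists U, V.
case=> [[Y [_ [t /(Br_setU1 _ AG)[U [V [AU GV ->]]] ->]]]
       |[Y [_ [t /(Br_setU1 _ BG)[U [V [BU GV ->]]] ->]]]];
  exists Y, (U `|` V); split=> //; apply/(Br_setU1 _ FG); exists U, V; split=> //.
- by left.
- by right.
Qed.

(** Axiom pairs are unordered, but [Ax] lists them, and the inversions may list a pair the other way
    round. *)
Lemma bl_idC A B : bl_id A B = bl_id B A.
Proof.
elim: A B => [a x|A1 I1 A2 I2|A1 I1 A2 I2] [b y|B1 B2|B1 B2] //=; last 2 first.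
- by rewrite I1 I2.
- by rewrite I1 I2.
apply/blgraphP; split=> [|e X] /=; first by rewrite setUC.
by rewrite ![[set x; y]]setUC; split=> -[xy -> ->]; split=> // yx; apply: xy.
Qed.

Lemma vert_bl_id A B : vert (bl_id A B) `<=` names A `|` names B.
Proof.
elim: A B => [a x|A1 I1 A2 I2|A1 I1 A2 I2] [b y|B1 B2|B1 B2] //=.
- by move=> z /=; rewrite /names /= !inE => -[->|->]; [left|right].
- rewrite !names_set1 names_Disj names_Conj => z.
  by move=> [[/I1|]|[/I2|]] /=; tauto.
- rewrite !names_set1 names_Disj names_Conj => z.
  by move=> [[/I1|]|[/I2|]] /=; tauto.
Qed.

(** Each label contains a label of the identity on a pair of immediate subformulas; the descent ends
    at an atomic edge, whose label contains the name of an atom of [A]. *)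
Lemma bl_id_hits A B e X : tri (bl_id A B) e X -> X `&` names A !=set0.
Proof.
elim: A B e X => [a x|A1 I1 A2 I2|A1 I1 A2 I2] [b y|B1 B2|B1 B2] //= e X.
- by move=> [_ _ ->]; exists x; split; [left|rewrite /names /= inE].
- rewrite names_Disj.
  move=> [[Y [Z [/I1[x [Yx Ax]] _ ->]]]|[Y [Z [/I2[x [Yx Ax]] _ ->]]]].
    by exists x; split; left.
  by exists x; split; [left|right].
- rewrite names_Conj.
  move=> [[Y [Z [/I1[x [Yx Ax]] _ ->]]]|[Y [Z [/I2[x [Yx Ax]] _ ->]]]].
    by exists x; split; left.
  by exists x; split; [left|right].
Qed.


(** * Alternating paths and composition *)

Section Paths.
Variables (I X : set N) (K L K' L' : blgraph N).
Hypotheses (subK : forall e, tri_mod I K e X -> tri_mod I K' e X)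
           (subL : forall e, tri_mod I L e X -> tri_mod I L' e X).

(** All edges of a path carry the same label, so inclusion of edges is assumed for this one [X]
    only. The inclusions needed for the two halves hold only for labels that meet, or only for
    labels that miss, a given set. *)
Lemma alt_path_sub x s : alt_path I X K L x s -> alt_path I X K' L' x s.
Proof.
case=> s0 us _ Is alt.
have {}alt : alternates I X K' L' x s \/ alternates I X L' K' x s.
  by case: alt => alt; [left|right] => i si; move: (alt i si);
     case: (odd i) => [/subL|/subK] || case: (odd i) => [/subK|/subL].
split=> // z /(nthP x)[i].
(* Vertex sets are not assumed to be included; instead, every vertex of the path is an endpoint of
   an edge that carries over. *)
have edge j (u : N) : j < size s ->
    [set nth x (x :: s) j; nth x (x :: s) j.+1] u ->
    (vert K' `|` vert L') u.
  move=> js ju; case: alt => /(_ j js)[Y [tY _]].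
  - by move: tY; case: (odd j) => tY; [right|left]; apply: (tri_vert tY);
       apply: (tri_sub tY).
  - by move: tY; case: (odd j) => tY; [left|right]; apply: (tri_vert tY);
       apply: (tri_sub tY).
(* Every vertex but the last starts an edge; the last one ends an edge because [s] is nonempty. *)
rewrite ltnS leq_eqVlt => /orP[/eqP -> <-|si <-]; last by apply: (edge i) => //; left.
case: s s0 edge {us Is alt} => // y s _ edge.
by apply: (edge (size s)) => //; right.
Qed.

Lemma odot_sub e : tri (odot I K L) e X -> tri (odot I K' L') e X.
Proof.
move=> [x [y [-> xy _ _ [_ [s [p [nIx nIy] ly]]]]]].
have {}p := alt_path_sub p.
have Xx := alt_path_head p nIx.
have Xy : X y by rewrite -ly; apply: alt_path_last p nIy.
(* The first edge suffices: its label is [Y] with [X] equal to [Y] minus [I]. *)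
have XV : X `<=` (vert K' `|` vert L') `\` I.
  case: p => s0 _ _ _ alt; case: s s0 alt {nIy ly} => // z s _ alt.
  case: alt => /(_ 0 isT) /= [Y [/tri_vert YV ->]] u [/YV Vu nIu];
    by split=> //; (left + right).
by exists x, y; split=> //; [exact: XV|exact: XV|split=> //; exists s].
Qed.

End Paths.

(** The label of a path is that of its first edge with [I] removed, and this removal deletes no
    element of [Z]. *)
Lemma odot_hits I Z K L :
  I `&` Z = set0 ->
  (forall e X, tri K e X -> X `&` Z !=set0) ->
  (forall e X, tri L e X -> X `&` Z !=set0) ->
  forall e X, tri (odot I K L) e X -> X `&` Z !=set0.
Proof.
move=> /disjointP IZ KZ LZ e X [x [y [_ _ _ _ [_ [s [[s0 _ _ _ alt] _ _]]]]]].
have [Y [[z [Yz Zz]] ->]] : exists Y, Y `&` Z !=set0 /\ X = Y `\` I.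
  by case: s s0 alt => // u s _ [] /(_ 0 isT) /= [Y [t ->]]; exists Y; split=> //;
     [apply: KZ t|apply: LZ t].
by exists z; split=> //; split=> // /IZ; apply.
Qed.

(** The set [Z] tells the summands apart: labels of [K1] and [L1] meet it, those of [K2] and [L2]
    cannot. As [I] misses [Z], this survives the removal of [I], and the common label of a path
    assigns all its edges to the same side. *)
Lemma odot_union I Z K1 K2 L1 L2 :
  I `&` Z = set0 ->
  (forall e X, tri K1 e X -> X `&` Z !=set0) ->
  (forall e X, tri L1 e X -> X `&` Z !=set0) ->
  vert K2 `&` Z = set0 -> vert L2 `&` Z = set0 ->
  odot I (bl_union K1 K2) (bl_union L1 L2) =
  bl_union (odot I K1 L1) (odot I K2 L2).
Proof.
move=> IZ K1Z L1Z K2Z L2Z; apply/blgraphP; split.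
  by rewrite /= -setDUl setUACA.
move=> e X; split; last first.
  by case; apply: odot_sub => e' [Y [t ->]]; exists Y; split=> //; (left + right).
(* If [X] meets [Z], an edge from a second summand would put a point of [Z] among its vertices. If
   not, an edge from a first summand has a label with a point of [Z], which lies outside [I] and
   hence in [X]. *)
have [XZ|XZ] := EM (X `&` Z !=set0).
  have side M1 M2 e' : vert M2 `&` Z = set0 ->
      tri_mod I (bl_union M1 M2) e' X -> tri_mod I M1 e' X.
    move=> /disjointP M2Z [Y [[t|t] XE]]; first by exists Y.
    by case: XZ => x [Xx Zx]; case: (M2Z x) => //; apply: (tri_vert t);
       move: Xx; rewrite XE => -[].
  by left; move: H; apply: odot_sub => e'; apply: side.
have side M1 M2 e' : (forall e Y, tri M1 e Y -> Y `&` Z !=set0) ->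
    tri_mod I (bl_union M1 M2) e' X -> tri_mod I M2 e' X.
  move=> M1Z [Y [[t|t] XE]]; last by exists Y.
  case: XZ; case: (M1Z _ _ t) => x [Yx Zx]; exists x; split=> //.
  rewrite XE; split=> // Ix; move: IZ => /disjointP; by apply; eauto.
by right; move: H; apply: odot_sub => e'; apply: side.
Qed.

End Graphs.

(** * Bl-graphs of derivations and of their inversions *)

Section Derivations.
Variables (At N : choiceType) (bar : At -> At).
Notation form := (formula At N).
Implicit Types (A B C D F : form) (G : {fset form}) (P Q R : tree At N).

Lemma derivation_concl P : derivation bar P -> sharing_free_set (concl P).
Proof. by case: P => [???|????|???|????|?????] []. Qed.

Lemma vert_sem P : derivation bar P -> vert (sem P) `<=` names_set (concl P).
Proof.
elim: P => [G A B|G A Q IQ R IR|G Q IQ R IR|G A B Q IQ|G A B Q IQ R IR] /= [_].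
- move=> _; rewrite !names_setU1 setUA; apply: setUSS => //; exact: vert_bl_id.
- move=> [AG cQ cR /IQ + /IR]; rewrite cQ cR !names_setU1.
  by rewrite names_neg => sQ sR x [[/sQ|/sR] []].
- by move=> [cQ cR /IQ + /IR]; rewrite cQ cR subUset.
- move=> [_ _ cQ /IQ]; rewrite cQ.
  by rewrite !names_setU1 names_Disj setUA.
- move=> [_ _ cQ cR [/IQ + /IR]]; rewrite cQ cR !names_setU1 names_Conj.
  by move=> sQ sR x [/sQ|/sR] [?|?]; [left; left|right|left; right|right].
Qed.

(** At an axiom the identity part of the label meets both principal formulas and the branch part
    meets each context formula. A cut removes only names apart from its conclusion. The use is at
    the rule introducing the inverted conjunction, where left inversion returns a premiss. *)
Lemma sem_hits P e X A :
  derivation bar P -> tri (sem P) e X -> A \in concl P -> X `&` names A !=set0.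
Proof.
elim: P e X A => [G A B|G A Q IQ R IR|G Q IQ R IR|G A B Q IQ|G A B Q IQ R IR]
  e X C /= [_].
- move=> _ [Y [Z [t GZ ->]]]; rewrite !in_fset1U => /or3P[/eqP ->|/eqP ->|CG].
  + by have [x [Yx Ax]] := bl_id_hits t; exists x; split=> //; left.
  + by move: t; rewrite bl_idC => /bl_id_hits[x [Yx Bx]]; exists x; split=> //; left.
  + by have [x [Zx Cx]] := Br_set_hits GZ CG; exists x; split=> //; right.
- move=> [AG cQ cR dQ dR] t CG; apply: odot_hits t.
  + exact: AG.
  + by move=> e' Y /IQ; apply=> //; rewrite cQ fset1Ur.
  + by move=> e' Y /IR; apply=> //; rewrite cR fset1Ur.
- by move=> [cQ cR dQ dR] [t|t] CG; [apply: IQ t _|apply: IR t _]; rewrite ?cQ ?cR.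
- move=> [_ _ cQ dQ] t; rewrite in_fset1U => /orP[/eqP ->|CG].
    have [|x [Xx Ax]] := IQ _ _ A dQ t; first by rewrite cQ fset1U1.
    by exists x; rewrite names_Disj; split=> //; left.
  by apply: IQ t _ => //; rewrite cQ !fset1Ur.
- move=> [_ _ cQ cR [dQ dR]] t; rewrite in_fset1U => /orP[/eqP ->|CG].
    rewrite names_Conj setIUr; case: t => t.
      by have [|x] := IQ _ _ A dQ t; [rewrite cQ fset1U1|exists x; left].
    by have [|x] := IR _ _ B dR t; [rewrite cR fset1U1|exists x; right].
  by case: t => t; [apply: IQ t _|apply: IR t _]; rewrite ?cQ ?cR ?fset1Ur.
Qed.

(** Only axioms need an argument: a principal disjunction unfolds through the recursive clause of
    [bl_id], and one in the context is handled by [wk_Disj]. A [DisjR] leaves the bl-graph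
    unchanged, and the other rules are congruences. *)
Lemma sem_invd A B P :
  derivation bar P -> Disj A B \in concl P -> sem (invd A B P) = sem P.
Proof.
set F := Disj A B.
elim: P => [G C D|G C Q IQ R IR|G Q IQ R IR|G C D Q IQ|G C D Q IQ R IR] /= [sh].
- move=> [CG DG CD] FP; case: eqP => [CF|CF].
    subst C; move: CG CD => /apartU1[_ /apart_Disj[AG BG]].
    case: D {sh DG FP} => [b y|D1 D2|D1 D2] //= _.
    (* The axioms produced by [invd_ax] put the subformulas of the dual formula first, hence the two
       swaps. *)
    by rewrite wk_union -!wkU1 // (bl_idC A) (bl_idC B).
  case: eqP => [DF|DF].
    subst D; move: DG CD => /apart_Disj[AG BG].
    case: C {sh CG FP CF} => [a x|C1 C2|C1 C2] //= _.
    by rewrite wk_union -!wkU1.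
  have FG : F \in G.
    by move: FP; rewrite !in_fset1U => /or3P[/eqP E|/eqP E|//]; [case: CF|case: DF].
  have /apart_Disj[AG BG] : apart F (G `\ F)%fset.
    by apply: sharing_free_setD1 sh FP _ => E EG; rewrite /= !fset1Ur.
  rewrite -{2}(fsetD1K FG) wk_Disj //; apply/apartU1; split=> //.
  by apply: sharing_free_Disj; apply: sh.1 FP.
- by move=> [_ cQ cR dQ dR] FG; rewrite IQ ?IR ?cQ ?cR ?fset1Ur.
- by move=> [cQ cR dQ dR] FG; rewrite IQ ?IR ?cQ ?cR.
- move=> [_ _ cQ dQ]; rewrite in_fset1U eq_sym; case: eqP => //= _ FG.
  by rewrite IQ ?cQ ?fset1Ur.
- move=> [_ _ cQ cR [dQ dR]]; rewrite in_fset1U /= => FG.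
  by rewrite IQ ?IR ?cQ ?cR ?fset1Ur.
Qed.

(** [sem_hits] speaks of derivations, and [invl A B P] is not shown to be one, so the induction is
    redone on [P]. *)
Lemma invl_hits A B P e X :
  derivation bar P -> Conj A B \in concl P ->
  tri (sem (invl A B P)) e X -> X `&` names A !=set0.
Proof.
set F := Conj A B.
elim: P e X => [G C D|G C Q IQ R IR|G Q IQ R IR|G C D Q IQ|G C D Q IQ R IR] e X /= [sh].
- move=> [CG DG CD] FP; case: eqP => [CF|CF].
    subst C; move: CD.
    case: D {sh CG DG FP} => [b y|D1 D2|D1 D2] //= _ [Y [Z [t _ ->]]].
    by move: t; rewrite bl_idC => /bl_id_hits[x [Yx Ax]]; exists x; split=> //; left.
  case: eqP => [DF|DF].
    subst D; move: CD.
    case: C {sh CG DG FP CF} => [a x|C1 C2|C1 C2] //= _ [Y [Z [t _ ->]]].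
    by move: t; rewrite bl_idC => /bl_id_hits[x [Yx Ax]]; exists x; split=> //; left.
  move=> [Y [Z [_ GZ ->]]].
  have [|x [Zx Ax]] := Br_set_hits (A := A) GZ; first by rewrite /= fset1U1.
  by exists x; split=> //; right.
- move=> [CG cQ cR dQ dR] FG; apply: odot_hits.
  + by move: CG => /(_ _ FG) /disjointP CF; apply/disjointP => x Cx Ax;
       apply: (CF x) => //; rewrite names_Conj; left.
  + by move=> e' Y; apply: IQ => //; rewrite cQ fset1Ur.
  + by move=> e' Y; apply: IR => //; rewrite cR fset1Ur.
- by move=> [cQ cR dQ dR] FG [t|t]; [apply: IQ t|apply: IR t]; rewrite ?cQ ?cR.
- move=> [_ _ cQ dQ]; rewrite in_fset1U /= => FG.
  by apply: IQ => //; rewrite cQ !fset1Ur.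
- move=> [_ _ cQ cR [dQ dR]]; rewrite in_fset1U eq_sym; case: eqP => /= [[CA _]|_ FG].
    by move=> _ t; apply: sem_hits dQ t _; rewrite cQ CA fset1U1.
  by case=> t; [apply: IQ t|apply: IR t]; rewrite ?cQ ?cR ?fset1Ur.
Qed.

(** Right inversion discards [A], and sharing-freeness keeps its names out of every other formula of
    the conclusion. Vertices are tracked rather than labels: they contain all labels and pass
    directly through unions and compositions. *)
Lemma invr_avoids A B P :
  derivation bar P -> Conj A B \in concl P ->
  vert (sem (invr A B P)) `&` names A = set0.
Proof.
set F := Conj A B => dP FP.
have AB : names A `&` names B = set0.
  by apply: sharing_free_Conj; apply: (derivation_concl dP).1 FP.
have avoid K G : vert K `&` names A = set0 -> apart A G ->
    (vert K `|` names_set G) `&` names A = set0.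
  by move=> KA /apart_names_set; rewrite setIUl KA set0U setIC.
have avoidid C D : names A `&` names C = set0 -> names A `&` names D = set0 ->
    vert (bl_id C D) `&` names A = set0.
  move=> /disjointP AC /disjointP AD; apply/disjointP => x.
  by move=> /vert_bl_id[Cx|Dx] Ax; [apply: AC Cx|apply: AD Dx].
elim: P dP FP => [G C D|G C Q IQ R IR|G Q IQ R IR|G C D Q IQ|G C D Q IQ R IR] /= [sh].
- move=> [CG DG CD] FP; case: eqP => [CF|CF].
    subst C; move: CG CD => /apartU1[+ /apart_Conj[AG BG]].
    rewrite names_Conj => FD.
    case: D {sh DG FP} FD => [b y|D1 D2|D1 D2] //= + _.
    rewrite names_Disj => /disjointP FD.
    apply: avoid; first apply: avoidid => //.
      by apply/disjointP => x Ax Dx; apply: (FD x); [left|right].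
    apply/apartU1; split=> //.
    by apply/disjointP => x Ax Dx; apply: (FD x); left.
  case: eqP => [DF|DF].
    subst D; move: DG CD => /apart_Conj[AG BG].
    move: CG => /apartU1[+ _]; rewrite names_Conj => FC.
    case: C {sh FP CF} FC => [a x|C1 C2|C1 C2] //= + _.
    rewrite names_Disj => /disjointP FC.
    apply: avoid; first apply: avoidid => //.
      by apply/disjointP => x Ax Cx; apply: (FC x); [right|left].
    apply/apartU1; split=> //.
    by apply/disjointP => x Ax Cx; apply: (FC x); left.
  have FG : F \in G.
    by move: FP; rewrite !in_fset1U => /or3P[/eqP E|/eqP E|//]; [case: CF|case: DF].
  have /apart_Conj[AG BG] : apart F (G `\ F)%fset.
    by apply: sharing_free_setD1 sh FP _ => E EG; rewrite /= !fset1Ur.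
  (* Here neither principal formula is [F], so both are disjoint from [F] and hence from its
     conjunct [A]. *)
  have avoidF E : E \in (C |` (D |` G))%fset -> E <> F -> names A `&` names E = set0.
    move=> EP EF; have : names F `&` names E = set0.
      by apply: sh.2 => // FE; apply: EF.
    rewrite names_Conj => /disjointP FE.
    by apply/disjointP => x Ax Ex; apply: (FE x) => //; left.
  apply: avoid; last by apply/apartU1.
  by apply: avoidid; apply: avoidF; rewrite // ?fset1U1 // fset1Ur ?fset1U1.
- move=> [_ cQ cR dQ dR] FG; apply/disjointP => x [KL _] Ax; case: KL => Kx.
  + by have /disjointP/(_ x Kx Ax) := IQ dQ ltac:(by rewrite cQ fset1Ur).
  + by have /disjointP/(_ x Kx Ax) := IR dR ltac:(by rewrite cR fset1Ur).
- by move=> [cQ cR dQ dR] FG; rewrite setIUl IQ ?IR ?cQ ?cR ?setU0.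
- move=> [_ _ cQ dQ]; rewrite in_fset1U /= => FG.
  by rewrite IQ ?cQ ?fset1Ur.
- move=> [CG _ cQ cR [dQ dR]]; rewrite in_fset1U eq_sym; case: eqP => /= [[CA DB]|_ FG].
    (* The inversion is the right premiss itself; its vertices are names of its conclusion, from
       which [A] is apart. *)
    move=> _; apply/disjointP => x /(vert_sem dR); rewrite cR -CA => GDx Cx.
    by move: (apart_names_set CG) => /disjointP; apply; eauto.
  by rewrite setIUl IQ ?IR ?cQ ?cR ?fset1Ur ?setU0.
Qed.

Lemma sem_invlr A B P :
  derivation bar P -> Conj A B \in concl P ->
  bl_union (sem (invl A B P)) (sem (invr A B P)) = sem P.
Proof.
set F := Conj A B.
elim: P => [G C D|G C Q IQ R IR|G Q IQ R IR|G C D Q IQ|G C D Q IQ R IR] /= [sh].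
- move=> [CG DG CD] FP; case: eqP => [CF|CF].
    subst C; move: DG CD.
    case: D {sh CG FP} => [b y|D1 D2|D1 D2] //= /apart_Disj[D1G D2G] _.
    by rewrite wk_union -!wkU1 // (bl_idC A) (bl_idC B).
  case: eqP => [DF|DF].
    subst D; move: CG CD => /apartU1[_].
    case: C {sh FP CF} => [a x|C1 C2|C1 C2] //= /apart_Disj[C1G C2G] _.
    by rewrite wk_union -!wkU1.
  have FG : F \in G.
    by move: FP; rewrite !in_fset1U => /or3P[/eqP E|/eqP E|//]; [case: CF|case: DF].
  have /apart_Conj[AG BG] : apart F (G `\ F)%fset.
    by apply: sharing_free_setD1 sh FP _ => E EG; rewrite /= !fset1Ur.
  by rewrite -{3}(fsetD1K FG) wk_Conj.
- move=> [CG cQ cR dQ dR] FG.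
  have FQ : F \in concl Q by rewrite cQ fset1Ur.
  have FR : F \in concl R by rewrite cR fset1Ur.
  (* Both premisses are split into halves, and the names of [A] serve as separating set. They miss
     the cut names because the cut formula is apart from [F]. *)
  rewrite -IQ // -IR // (odot_union (Z := names A)) //.
  + apply/disjointP => x Cx Ax; move: (CG _ FG) => /disjointP.
    by apply; [exact: Cx|rewrite names_Conj; left].
  + by move=> e X; apply: invl_hits.
  + by move=> e X; apply: invl_hits.
  + exact: invr_avoids.
  + exact: invr_avoids.
- by move=> [cQ cR dQ dR] FG; rewrite bl_unionACA IQ ?IR ?cQ ?cR.
- move=> [_ _ cQ dQ]; rewrite in_fset1U /= => FG.
  by rewrite IQ ?cQ ?fset1Ur.
- move=> [_ _ cQ cR [dQ dR]]; rewrite in_fset1U eq_sym; case: eqP => //= _ FG.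
  by rewrite bl_unionACA IQ ?IR ?cQ ?cR ?fset1Ur.
Qed.

End Derivations.

Theorem theorem2 (At : choiceType) (bar : At -> At)
    (barK : involutive bar) (bar_neq : forall a : At, bar a <> a)
    (N : countType) (N_infinite : infinite_set [set: N]%classic)
    (G : {fset formula At N}) (A : formula At N) (P : tree At N)
    (P_derivation : derivation bar P)
    (A_apart : apart A G) (P_concl : concl P = (A |` G)%fset)
    (A_nonatomic : ~~ atomic A) :
  sem (isl P A) = sem P.
Proof.
have AP : A \in concl P by rewrite P_concl fset1U1.
(* The rule that [isl] reapplies computes away: [DisjR] keeps the bl-graph of the inversion, and
   [ConjR] unites the two halves. *)
case: A AP {A_apart P_concl} A_nonatomic => [//|B C|B C] AP _ /=.
- exact: sem_invd P_derivation AP.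
- exact: sem_invlr P_derivation AP.
Qed.
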